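(* Let $A\in\mathbb{R}^{m\times m}$ be symmetric positive definite with orthonormal eigenvectors $z_1,\dots,z_m$ and corresponding eigenvalues $0<\lambda_1\leqslant\lambda_2\leqslant\dots\leqslant\lambda_m$ (with $m\geqslant 2$), let $b\in\mathbb{R}^m$, and let $x$ be the exact solution of $Ax=b$. Let $x_0\in\mathbb{R}^m$ be an initial guess vector, write $$x-x_0=\sum_{i=1}^m\gamma_i z_i,$$ and let $\bar{x}_0$ be the vector defined by $$x-\bar{x}_0=\sum_{i=2}^m\gamma_i z_i .$$ Let $x_j$, $j=1,2,\dots$, be the iterands of the conjugate gradient method applied to $Ax=b$ with initial guess $x_0$. Put $$C_2=\frac{\sqrt{\kappa_2}-1}{\sqrt{\kappa_2}+1},\qquad \kappa_2=\frac{\lambda_m}{\lambda_2}.$$ Let $J$ be a positive integer and suppose that there exists a constant $\delta>0$ such that $$\frac{\lambda_1\gamma_1^2}{\sum_{i=2}^m\lambda_i\gamma_i^2}=\frac{\lambda_1\gamma_1^2}{\|x-\bar{x}_0\|_A^2}\leqslant 4C_2^{2j}\,\delta\qquad\text{for } j=1,\dots,J .$$ Then $$\|x-x_j\|_A^2\leqslant 4(1+\delta)\,C_2^{2j}\,\|x-x_0\|_A^2\qquad\text{for } j=1,\dots,J .$$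
   Context: For a symmetric positive definite matrix $A$, $\|v\|_A=\sqrt{v^{\top}Av}$. Round-off errors are neglected, i.e. the conjugate gradient (CG) method is considered in exact arithmetic. The CG iterands $x_j$ started at $x_0$ are characterized by: $x_j$ is the unique minimizer of $\|x-y\|_A$ over $y\in x_0+\mathrm{span}\{r_0,Ar_0,\dots,A^{j-1}r_0\}$, where $r_0=b-Ax_0$. Equivalently, $$\|x-x_j\|_A=\min_{q}\|q(A)(x-x_0)\|_A,$$ where the minimum is over all real polynomials $q$ of degree at most $j$ with constant term $q(0)=1$. If the exact solution is reached at some step, all later iterands are taken equal to $x$. The quotient in the hypothesis is understood to have a nonzero denominator. *)

(* Defs.v *)
From HB Require Import structures.
From mathcomp Require Import all_boot all_order all_algebra.
From mathcomp Require Import reals.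
Set Implicit Arguments.
Unset Strict Implicit.
Unset Printing Implicit Defensive.
Import Order.TTheory GRing.Theory Num.Theory.
Local Open Scope ring_scope.

Definition spd (R : realType) (m : nat) (A : 'M[R]_m) : Prop :=
  A^T = A /\ forall v : 'cV[R]_m, v != 0 -> 0 < (v^T *m A *m v) 0 0.

Definition anorm (R : realType) (m : nat) (A : 'M[R]_m) (v : 'cV[R]_m) : R :=
  Num.sqrt ((v^T *m A *m v) 0 0).

Definition orthonormal_family (R : realType) (m : nat)
    (z : 'I_m -> 'cV[R]_m) : Prop :=
  forall i j : 'I_m, ((z i)^T *m z j) 0 0 = (i == j)%:R.

(* span {r, A r, ..., A^(j-1) r}; in particular krylov A r 0 = 0 *)
Definition krylov (R : realType) (m : nat) (A : 'M[R]_m) (r : 'cV[R]_m)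
    (j : nat) : {vspace 'cV[R]_m} :=
  <<[seq A ^+ i *m r | i <- iota 0 j]>>%VS.

(* y is the j-th conjugate gradient iterand in exact arithmetic: the minimizer
   of |x - y|_A over x0 + span {r0, ..., A^(j-1) r0}, where x solves A x = b
   and r0 = b - A x0.  For A positive definite the minimizer is unique, it is
   x0 for j = 0, and it stays equal to x once x has been reached. *)
Definition is_cg_iterand (R : realType) (m : nat) (A : 'M[R]_m)
    (b x x0 : 'cV[R]_m) (j : nat) (y : 'cV[R]_m) : Prop :=
  y - x0 \in krylov A (b - A *m x0) j /\
  forall w : 'cV[R]_m, w - x0 \in krylov A (b - A *m x0) j ->
    anorm A (x - y) <= anorm A (x - w).

Definition cg_rate (R : realType) (kappa : R) : R :=
  (Num.sqrt kappa - 1) / (Num.sqrt kappa + 1).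

(* The A-norm of an eigenvector expansion; with P i := (0 < i)%N it gives
   |x - xbar0|_A^2 = \sum_(i | 0 < i) lam i * gamma i ^+ 2. *)
Lemma sqr_anorm_eigen_sum (R : realType) (m : nat) (A : 'M[R]_m)
    (z : 'I_m -> 'cV[R]_m) (lam gamma : 'I_m -> R) (P : pred 'I_m) :
  spd A -> orthonormal_family z -> (forall i, A *m z i = lam i *: z i) ->
  anorm A (\sum_(i | P i) gamma i *: z i) ^+ 2
    = \sum_(i | P i) lam i * gamma i ^+ 2.
Proof.
move=> [_ posA] oz Az; set v := \sum_(i | P i) _.
rewrite /anorm sqr_sqrtr; last first.
  have [->|/posA/ltW //] := eqVneq v 0.
  by rewrite mulmx0 mxE.
rewrite -mulmxA {2}/v mulmx_sumr mulmx_sumr summxE; apply: eq_bigr => i Pi.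
rewrite -scalemxAr Az -!scalemxAr !mxE.
have -> : \sum_j v^T 0 j * z i j 0 = gamma i.
  transitivity ((v^T *m z i) 0 0); first by rewrite mxE.
  rewrite /v linear_sum /= mulmx_suml summxE (bigD1 i) //= big1 => [|j /andP[_ ji]].
    by rewrite linearZ /= -scalemxAl mxE oz eqxx mulr1 addr0.
  by rewrite linearZ /= -scalemxAl mxE oz (negPf ji) mulr0.
by rewrite mulrCA -expr2.
Qed.

(* Main.v *)
(* Test the minimization property of x_j with the residual polynomial of degree
   j obtained from the Chebyshev polynomial on [lambda_2, lambda_m], scaled to
   take the value 1 at 0.  It is at most 2 C_2^j in absolute value on
   [lambda_2, lambda_m], and on [0, lambda_2], where lambda_1 lies, its absolute
   value is at most 1.  So the component along z_1 does not grow, and it is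
   controlled by the hypothesis on gamma_1. *)
Require Import Defs.
From HB Require Import structures.
From mathcomp Require Import all_boot all_order all_algebra.
From mathcomp Require Import reals.
From mathcomp Require Import ring lra.
Set Implicit Arguments.
Unset Strict Implicit.
Unset Printing Implicit Defensive.
Import Order.TTheory GRing.Theory Num.Theory.
Local Open Scope ring_scope.

(* Homogenized Chebyshev polynomials of both kinds,
   (h^k T_k(x/h), h^(k-1) U_(k-1)(x/h)): no division, so h = 0 is allowed. *)
Fixpoint chebTU (S : comNzRingType) (h x : S) (k : nat) : S * S :=
  if k is k'.+1 then
    let TU := chebTU h x k' in
    (x * TU.1 + (x ^+ 2 - h ^+ 2) * TU.2, TU.1 + x * TU.2)
  else (1, 0).

(** With [d] a formal square root of [x ^+ 2 - h ^+ 2], one step of the recursion multiplies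
    [T + d * U] by [x + d]. The left side is the norm of [T + d * U], and [x + d] has norm
    [h ^+ 2]. *)
Lemma chebTU_pell (S : comNzRingType) (h x : S) k :
  (chebTU h x k).1 ^+ 2 - (x ^+ 2 - h ^+ 2) * (chebTU h x k).2 ^+ 2
    = (h ^+ k) ^+ 2.
Proof.
elim: k => [|k IH] /=; first by ring.
by rewrite [h ^+ k.+1]exprS exprMn -IH; ring.
Qed.

Lemma chebTU_exp (S : comNzRingType) (h x d : S) k :
  d ^+ 2 = x ^+ 2 - h ^+ 2 ->
  (chebTU h x k).1 + d * (chebTU h x k).2 = (x + d) ^+ k.
Proof.
move=> dE; elim: k => [|k IH] /=; first by ring.
by rewrite [(x + d) ^+ _]exprS -IH -dE; ring.
Qed.

(** Taking evaluation at a point for [f] identifies the values of the Chebyshev polynomial with the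
    scalar recursion. *)
Lemma chebTU_morph (S S' : comNzRingType) (f : {rmorphism S -> S'}) (h x : S) k :
  chebTU (f h) (f x) k = (f (chebTU h x k).1, f (chebTU h x k).2).
Proof.
elim: k => [|k IH] /=; first by rewrite rmorph0 rmorph1.
by rewrite IH /= !(rmorphB, rmorphD, rmorphM, rmorphXn).
Qed.

(** For [|x| <= h] the factor [x ^+ 2 - h ^+ 2] is nonpositive, so the Pell identity bounds the
    square of the first component. *)
Lemma chebTU_le1 (R : realDomainType) (h x : R) k :
  0 <= h -> `|x| <= h -> `|(chebTU h x k).1| <= h ^+ k.
Proof.
move=> h0 xh; rewrite -(@ler_pXn2r _ 2) ?nnegrE ?exprn_ge0 //.
rewrite real_normK ?num_real // -(chebTU_pell h x k) lerDl -mulNr mulr_ge0 ?sqr_ge0 //.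
rewrite opprB subr_ge0 -(real_normK (num_real x)).
by rewrite ler_pXn2r ?nnegrE.
Qed.

(** From [h] on, every coefficient of the recursion is nonnegative and nondecreasing in the
    argument; the two components feed each other, hence the joint induction. *)
Lemma chebTU_mono (R : realDomainType) (h x y : R) k :
  0 <= h -> h <= x -> x <= y ->
  0 <= (chebTU h x k).1 <= (chebTU h y k).1 /\
  0 <= (chebTU h x k).2 <= (chebTU h y k).2.
Proof.
move=> h0 hx xy; have x0 := le_trans h0 hx; have y0 := le_trans x0 xy.
have x2 : 0 <= x ^+ 2 - h ^+ 2 by rewrite subr_ge0 ler_pXn2r.
have xy2 : x ^+ 2 - h ^+ 2 <= y ^+ 2 - h ^+ 2 by rewrite lerD2r ler_pXn2r.
elim: k => [|k [/andP[T0 TT] /andP[U0 UU]]] /=.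
  by rewrite ler01 !lexx.
by rewrite !addr_ge0 ?mulr_ge0 // !lerD // ler_pM.
Qed.

Lemma size_chebTU (R : comNzRingType) (h x : {poly R}) k :
  (size h <= 1)%N -> (size x <= 2)%N ->
  (size (chebTU h x k).1 <= k.+1)%N /\ (size (chebTU h x k).2 <= k)%N.
Proof.
move=> sh sx.
have szM (p q : {poly R}) i j : (size p <= i.+1)%N -> (size q <= j)%N ->
    (size (p * q)%R <= i + j)%N.
  move=> sp sq; apply: leq_trans (size_polyMleq p q) _.
  by rewrite -subn1 leq_subLR add1n -addSn leq_add.
have sd : (size (x ^+ 2 - h ^+ 2)%R <= 3)%N.
  rewrite (leq_trans (size_polyD _ _)) // geq_max size_polyN !expr2.
  by rewrite (szM _ _ 1 2) //= (leq_trans (szM _ _ 0 1 sh sh)).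
elim: k => [|k [sT sU]] /=; first by rewrite size_poly1 size_poly0.
split; rewrite (leq_trans (size_polyD _ _)) // geq_max.
  by rewrite (szM _ _ 1 k.+1) //= (szM _ _ 2 k).
by rewrite sT (szM _ _ 1 k).
Qed.

Lemma cg_residual_poly (R : realType) (a b : R) (j : nat) :
  0 < a -> a <= b ->
  exists q : {poly R},
    [/\ (size q <= j.+1)%N, q.[0] = 1,
        forall t : R, 0 <= t <= a -> `|q.[t]| <= 1
      & forall t, a <= t <= b -> `|q.[t]| <= 2 * cg_rate (b / a) ^+ j].
Proof.
move=> a0 ab; have b0 := lt_le_trans a0 ab.
(* The map from [t] to [a + b - 2 * t] sends [[a, b]] onto [[-(b - a), b - a]] and [[0, a]] onto
   [[b - a, a + b]]. The witness will be [T t / T 0]. *)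
pose T (t : R) := (chebTU (b - a) (a + b - 2 * t) j).1.
pose Tp := (chebTU (b - a)%:P ((a + b)%:P - 2%:P * 'X) j).1.
have TpE t : Tp.[t] = T t.
  have := chebTU_morph (horner_eval t) (b - a)%:P ((a + b)%:P - 2%:P * 'X) j.
  by rewrite /T /= /horner_eval !hornerE => ->.
have h0 : 0 <= b - a by rewrite subr_ge0.
pose u := Num.sqrt a; pose v := Num.sqrt b.
have u0 : 0 < u by rewrite sqrtr_gt0.
have uv : u <= v by rewrite ler_wsqrtr.
have ua : u ^+ 2 = a by rewrite sqr_sqrtr // ltW.
have vb : v ^+ 2 = b by rewrite sqr_sqrtr // ltW.
have v0 := lt_le_trans u0 uv.
have rateE : cg_rate (b / a) = (v - u) / (v + u).
  rewrite /cg_rate sqrtrM ?(ltW b0) // sqrtrV ?(ltW a0) // -/u -/v.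
  by field; rewrite !gt_eqF ?addr_gt0 // divr_gt0.
(* At [t = 0] the square root is [d = 2 * u * v], and the argument plus or minus [d] is
   [(v + u) ^+ 2] or [(v - u) ^+ 2]. Adding the expansions for [d] and [- d] cancels the second
   component; then the nonnegative [(v - u)] term is dropped. *)
have T0E : ((v + u) ^+ 2) ^+ j <= 2 * T 0.
  have dE : (2 * u * v) ^+ 2 = (a + b - 2 * 0) ^+ 2 - (b - a) ^+ 2.
    by rewrite -ua -vb; ring.
  have dE' : (- (2 * u * v)) ^+ 2 = (a + b - 2 * 0) ^+ 2 - (b - a) ^+ 2.
    by rewrite sqrrN.
  have := chebTU_exp j dE; have := chebTU_exp j dE'; rewrite -/(T 0).
  have -> : a + b - 2 * 0 + 2 * u * v = (v + u) ^+ 2 by rewrite -ua -vb; ring.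
  have -> : a + b - 2 * 0 - 2 * u * v = (v - u) ^+ 2 by rewrite -ua -vb; ring.
  have : 0 <= ((v - u) ^+ 2) ^+ j by rewrite exprn_ge0 ?sqr_ge0.
  lra.
have vu : 0 < v + u by rewrite addr_gt0.
have T0 : 0 < T 0.
  have : 0 < ((v + u) ^+ 2) ^+ j by rewrite !exprn_gt0.
  lra.
exists (Tp * (T 0)^-1%:P); split=> [|||t /andP[at_ tb]].
- rewrite mulrC mul_polyC (leq_trans (size_scale_leq _ _)) //.
  apply: (size_chebTU _ _ _).1; first by rewrite size_polyC leq_b1.
  rewrite (leq_trans (size_polyD _ _)) // geq_max size_polyN mul_polyC.
  rewrite (leq_trans (size_scale_leq _ _)) ?size_polyX // andbT.
  by rewrite (leq_trans (size_polyC_leq1 _)).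
- by rewrite hornerM hornerC TpE divff // gt_eqF.
- move=> t /andP[t0 ta]; rewrite hornerM hornerC TpE normrM normfV.
  rewrite (gtr0_norm T0) ler_pdivrMr // mul1r.
  have hx : b - a <= a + b - 2 * t by lra.
  have xy : a + b - 2 * t <= a + b - 2 * 0 by lra.
  have [/andP[Tt0 TtT] _] := chebTU_mono j h0 hx xy.
  by rewrite ger0_norm.
rewrite hornerM hornerC TpE normrM normfV (gtr0_norm T0) ler_pdivrMr //.
have xh : `|a + b - 2 * t| <= b - a by rewrite ler_norml; apply/andP; split; lra.
apply: le_trans (chebTU_le1 j h0 xh) _; rewrite rateE.
(* Since [b - a = (v - u) * (v + u)], the bound [(b - a) ^+ j] on [T t] is the rate to the power [j]
   times the lower bound on [2 * T 0]. *)
have -> : (b - a) ^+ j = ((v - u) / (v + u)) ^+ j * ((v + u) ^+ 2) ^+ j.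
  rewrite -exprMn; congr (_ ^+ _); rewrite -ua -vb.
  by field; rewrite gt_eqF.
rewrite mulrAC [2 * _ * _]mulrC ler_wpM2l // exprn_ge0 // divr_ge0 ?(ltW vu) //.
by rewrite subr_ge0.
Qed.

Lemma expmx_eigen (R : comNzRingType) (m : nat) (A : 'M[R]_m) (v : 'cV[R]_m)
    (l : R) k :
  A *m v = l *: v -> A ^+ k *m v = l ^+ k *: v.
Proof.
move=> Av; elim: k => [|k IH]; first by rewrite expr0 scale1r mul1mx.
by rewrite exprSr -mulmxA Av -scalemxAr IH scalerA exprS.
Qed.

Lemma cg_iterand_le (R : realType) (m : nat) (A : 'M[R]_m)
    (z : 'I_m -> 'cV[R]_m) (lam gamma : 'I_m -> R) (b x x0 y : 'cV[R]_m)
    (j : nat) (q : {poly R}) :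
  spd A -> orthonormal_family z -> (forall i, A *m z i = lam i *: z i) ->
  A *m x = b -> x - x0 = \sum_i gamma i *: z i ->
  is_cg_iterand A b x x0 j y -> (size q <= j.+1)%N -> q.[0] = 1 ->
  anorm A (x - y) ^+ 2 <= \sum_i lam i * (gamma i * q.[lam i]) ^+ 2.
Proof.
move=> spdA oz Az Axb x0E [_ ymin] sq q0.
have r0E : b - A *m x0 = \sum_i gamma i *: (lam i *: z i).
  rewrite -Axb -mulmxBr x0E mulmx_sumr; apply: eq_bigr => i _.
  by rewrite -scalemxAr Az.
(* Chosen so that [x - w] is [q(A)] applied to [x - x0]: the constant term 1 gives [x - x0], and the
   residual, being [A] applied to [x - x0], absorbs one power of [A]. Hence the shifted coefficient
   index. *)
pose w := x0 - \sum_(k < j) q`_k.+1 *: (A ^+ k *m (b - A *m x0)).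
have wK : w - x0 \in krylov A (b - A *m x0) j.
  rewrite /w addrAC subrr add0r rpredN rpred_sum // => k _; apply/rpredZ/memv_span.
  by apply/mapP; exists (k : nat); rewrite // mem_iota ltn_ord.
have xwE : x - w = \sum_i (gamma i * q.[lam i]) *: z i.
  rewrite /w opprB addrCA addrC x0E.
  under [X in _ + X = _]eq_bigr => k _ do rewrite r0E mulmx_sumr scaler_sumr.
  rewrite exchange_big -big_split /=; apply: eq_bigr => i _.
  rewrite (horner_coef_wide _ sq) big_ord_recl /= expr0 mulr1 -horner_coef0 q0.
  rewrite mulrDr mulr1 scalerDl mulr_sumr scaler_suml; congr (_ + _).
  apply: eq_bigr => k _; rewrite -!scalemxAr (expmx_eigen _ (Az i)) !scalerA.
  by rewrite /bump /= add1n exprS; congr (_ *: _); ring.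
rewrite -(sqr_anorm_eigen_sum (fun i => gamma i * q.[lam i]) xpredT spdA oz Az).
by rewrite -xwE ler_pXn2r ?nnegrE ?sqrtr_ge0 ?ymin.
Qed.

(* The dimension is m = n.+2; the paper's indices 1, 2, m are the elements
   ord0, 1 and ord_max of 'I_n.+2. *)
Theorem theorem3p1 (R : realType) (n : nat) (A : 'M[R]_n.+2)
  (z : 'I_n.+2 -> 'cV[R]_n.+2) (lam : 'I_n.+2 -> R)
  (b x x0 xbar0 : 'cV[R]_n.+2) (gamma : 'I_n.+2 -> R)
  (xs : nat -> 'cV[R]_n.+2) (J : nat) (delta : R)
  (spdA : spd A)
  (oz : orthonormal_family z)
  (Az : forall i, A *m z i = lam i *: z i)
  (lam_gt0 : 0 < lam ord0)
  (lam_sorted : forall i j : 'I_n.+2, (i <= j)%N -> lam i <= lam j)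
  (Axb : A *m x = b)
  (x0E : x - x0 = \sum_(i < n.+2) gamma i *: z i)
  (xbar0E : x - xbar0 = \sum_(i < n.+2 | (0 < i)%N) gamma i *: z i)
  (xsP : forall j : nat, is_cg_iterand A b x x0 j (xs j)) :
  let kappa2 := lam ord_max / lam 1 in
  let C2 := cg_rate kappa2 in
  (0 < J)%N ->
  0 < delta ->
  anorm A (x - xbar0) != 0 ->
  (forall j : nat, (1 <= j <= J)%N ->
     lam ord0 * gamma ord0 ^+ 2 / anorm A (x - xbar0) ^+ 2
       <= 4 * C2 ^+ (2 * j) * delta) ->
  forall j : nat, (1 <= j <= J)%N ->
    anorm A (x - xs j) ^+ 2
      <= 4 * (1 + delta) * C2 ^+ (2 * j) * anorm A (x - x0) ^+ 2.
Proof.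
move=> kappa2 C2 _ d0 S0 hyp j jJ.
have lam1_le (i : 'I_n.+2) : (0 < i)%N -> lam 1 <= lam i by move=> i0; apply: lam_sorted.
have lam_le (i : 'I_n.+2) : lam i <= lam ord_max by apply: lam_sorted; rewrite -ltnS.
have l1 : 0 < lam 1 by apply: lt_le_trans lam_gt0 (lam_sorted _ _ _).
have [q [sq q0 qle1 qle]] := cg_residual_poly j l1 (lam_le 1).
apply: le_trans (cg_iterand_le spdA oz Az Axb x0E (xsP j) sq q0) _.
have SE := sqr_anorm_eigen_sum gamma (fun i => (0 < i)%N) spdA oz Az.
have NE := sqr_anorm_eigen_sum gamma xpredT spdA oz Az.
rewrite -xbar0E in SE; rewrite -x0E in NE.
have Spos : 0 < anorm A (x - xbar0) ^+ 2.
  by rewrite lt_def sqrf_eq0 S0 sqr_ge0.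
have := hyp j jJ; rewrite ler_pdivrMr // -/C2 => g0.
have tailE (F : 'I_n.+2 -> R) : \sum_i F i = F ord0 + \sum_(i < n.+2 | (0 < i)%N) F i.
  by rewrite (bigD1 ord0) //=; congr (_ + _); apply: eq_bigl => i; rewrite lt0n.
have head0 : lam ord0 * (gamma ord0 * q.[lam ord0]) ^+ 2
    <= lam ord0 * gamma ord0 ^+ 2.
  rewrite ler_pM2l // exprMn ler_piMr ?sqr_ge0 // -real_normK ?num_real //.
  by rewrite expr_le1 // qle1 // ltW //= lam_sorted.
have tail : \sum_(i < n.+2 | (0 < i)%N) lam i * (gamma i * q.[lam i]) ^+ 2
    <= 4 * C2 ^+ (2 * j) * anorm A (x - xbar0) ^+ 2.
  rewrite SE mulr_sumr; apply: ler_sum => i i0.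
  have li := lt_le_trans l1 (lam1_le i i0).
  rewrite [leRHS]mulrCA ler_pM2l // exprMn mulrC ler_wpM2r ?sqr_ge0 //.
  have -> : 4 * C2 ^+ (2 * j) = (2 * C2 ^+ j) ^+ 2.
    by rewrite [(2 * _) ^+ 2]exprMn -exprM [(j * 2)%N]mulnC; congr (_ * _); ring.
  have qi : `|q.[lam i]| <= 2 * C2 ^+ j by apply: qle; rewrite lam1_le ?lam_le.
  by rewrite -real_normK ?num_real // ler_pXn2r // nnegrE ?(le_trans _ qi).
have SN : anorm A (x - xbar0) ^+ 2 <= anorm A (x - x0) ^+ 2.
  by rewrite NE SE tailE lerDr mulr_ge0 ?sqr_ge0 ?ltW.
rewrite tailE; apply: le_trans (lerD head0 tail) _.
(* The tail contributes the 1 and, by the hypothesis on [gamma ord0], the head contributes the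
   [delta] in the factor [1 + delta]. *)
apply: (@le_trans _ _ (4 * (1 + delta) * C2 ^+ (2 * j) * anorm A (x - xbar0) ^+ 2)).
  by rewrite -subr_ge0 in g0; rewrite -subr_ge0; apply: le_trans g0 _; lra.
rewrite ler_wpM2l // !mulr_ge0 ?addr_ge0 ?ler01 ?(ltW d0) //.
by rewrite exprM exprn_ge0 ?sqr_ge0.
Qed.
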